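(* Let $n>2$ be an integer and let $k$ be an odd positive integer with $k<2^{n}$. Then $P_{k}(n)$, the submonoid of $(\mathbb{N},+)$ generated by $\{k2^{n+i}+1 \mid i\in\mathbb{N}\}$, is a numerical semigroup.
   Context: $\mathbb{N}$ denotes the set of non-negative integers. For a subset $A\subseteq\mathbb{N}$, $\langle A\rangle$ denotes the set of all finite sums $\sum t_a a$ with $a\in A$, $t_a\in\mathbb{N}$ (including $0$). A numerical semigroup is a subset $S\subseteq\mathbb{N}$ containing $0$, closed under addition, with $\mathbb{N}\setminus S$ finite. $P_k(n)=\langle\{k2^{n+i}+1\mid i\in\mathbb{N}\}\rangle$. *)

(* Defs.v *)
From mathcomp Require Import all_boot finmap.
From mathcomp Require Import boolp classical_sets functions cardinality.

Set Implicit Arguments.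
Unset Strict Implicit.
Unset Printing Implicit Defensive.

Local Open Scope classical_set_scope.
Local Open Scope nat_scope.

Definition generated_submonoid (A : set nat) : set nat :=
  [set x | exists (F : {fset nat}) (t : nat -> nat),
    [set` F] `<=` A /\ x = \sum_(a <- F) t a * a].

Definition numerical_semigroup (S : set nat) : Prop :=
  [/\ S 0,
      forall x y : nat, S x -> S y -> S (x + y)
    & finite_set (~` S)].

Definition P (k n : nat) : set nat :=
  generated_submonoid [set k * 2 ^ (n + i) + 1 | i in [set: nat]].

(* Main.v *)
Require Import Defs.
From mathcomp Require Import all_boot.
From mathcomp Require Import finmap zify.
From mathcomp Require Import classical_sets cardinality.

(** The two smallest generators are [a = k * 2 ^ n + 1] and [2 * a - 1], so they
    are coprime and the monoid contains every integer from [a * (2 * a - 1)] on: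
    if [a] divides [x + s] with [s <= a], then [a] divides
    [x - s * (2 * a - 1) = (x + s) - 2 * a * s]. *)

(** Extending the coefficients by zero brings two combinations with different supports to the union
    of these supports, where they can be added termwise. *)
Lemma sum_fset_widen (F G : {fset nat}) (t : nat -> nat) :
  {subset F <= G} ->
  \sum_(a <- F) t a * a = \sum_(a <- G) (if a \in F then t a else 0) * a.
Proof.
move=> sFG; under [RHS]eq_bigr do rewrite (fun_if (muln^~ _)) mul0n.
rewrite -big_mkcond -[RHS]big_filter /=; apply: perm_big; apply: uniq_perm.
- exact: fset_uniq.
- by rewrite filter_uniq ?fset_uniq.
- move=> a; rewrite mem_filter.
  by apply/idP/andP => [aF|[]//]; split=> //; exact: sFG.
Qed.

Lemma generated_submonoid0 (A : set nat) : generated_submonoid A 0.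
Proof.
exists fset0%fset, (fun=> 0); split; last by rewrite big_seq_fset0.
by move=> a; rewrite /= inE.
Qed.

Lemma generated_submonoidD (A : set nat) (x y : nat) :
  generated_submonoid A x -> generated_submonoid A y ->
  generated_submonoid A (x + y).
Proof.
move=> [F [t [FA ->]]] [G [u [GA ->]]].
exists (F `|` G)%fset.
exists (fun a => (if a \in F then t a else 0) + (if a \in G then u a else 0)).
split; first by move=> a /=; rewrite inE => /orP[/FA|/GA].
under [RHS]eq_bigr do rewrite mulnDl.
rewrite big_split /=; congr (_ + _); apply: sum_fset_widen => a aFG;
  by rewrite inE aFG ?orbT.
Qed.

Lemma generated_submonoidM (A : set nat) (m a : nat) :
  A a -> generated_submonoid A (m * a).
Proof.
move=> Aa; exists [fset a]%fset, (fun=> m); split.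
  by move=> b /=; rewrite inE => /eqP ->.
by rewrite big_seq_fset1.
Qed.

Lemma ge_mul_representable (a x : nat) : 0 < a -> a * (2 * a - 1) <= x ->
  exists s t, x = s * (2 * a - 1) + t * a.
Proof.
(* With [q = x %/ a], this [s] gives [x + s = (q + 1) * a]; it is [a], not 0, when [a] divides [x].
   The subtraction in the second witness does not truncate, since [2 * s <= 2 * a <= q + 1]. *)
move=> a_gt0 lex; set s := a - x %% a; exists s, (x %/ a + 1 - 2 * s).
have := divn_eq x a; have := ltn_pmod x a_gt0.
have : 2 * a - 1 <= x %/ a by rewrite leq_divRL // mulnC.
rewrite {}/s; move: (x %/ a) (x %% a) => q r le_q lt_r ->.
nia.
Qed.

Theorem theorem2 (n k : nat) (hn : 2 < n) (hk_odd : odd k) (hk_pos : 0 < k)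
    (hk_lt : k < 2 ^ n) :
  numerical_semigroup (P k n).
Proof.
split; [exact: generated_submonoid0 | exact: generated_submonoidD |].
pose a := k * 2 ^ n + 1.
apply: (sub_finite_set _ (finite_II (a * (2 * a - 1)))) => x Px /=.
rewrite ltnNge; apply/negP => lex; apply: Px.
have [|s [t ->]] := ge_mul_representable _ _ _ lex; first by rewrite /a addn1.
apply: generated_submonoidD; apply: generated_submonoidM.
(* Doubling [a] counts its summand 1 twice, so [2 * a - 1 = k * 2 ^ (n + 1) + 1]. *)
- by exists 1 => //; rewrite /a expnD; lia.
- by exists 0 => //; rewrite addn0.
Qed.
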